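(* Let $n\ge 2$, $Q(x_1,\dots,x_n,y)=x_1^2+\dots+x_n^2-y^2$, $\mathbf G=\mathrm{SO}_Q$, $G$ the identity component of $\mathbf G(\mathbb R)$, and let $\Gamma\subset G\cap\mathbf G(\mathbb Q)$ be a subgroup commensurable with $\mathbf G(\mathbb Z)$, acting by isometries on the upper half space model $\mathbb H^n\subset\mathbb R^n$ of hyperbolic $n$-space. Let $\pi_\Gamma:\mathbb H^n\to\Gamma\backslash\mathbb H^n$ be the projection. Let $\mathbf v=(v_1,\dots,v_{n-1})\in\mathbb R^{n-1}$ be a non-zero vector and, for $s\in\mathbb R$, let $\mathcal I_{s\mathbf v}=\{t(sv_1,\dots,sv_{n-1},1): t>0\}\subset\mathbb H^n$. Assume that $\mathbf v$ is not contained in any proper $\mathbb Q$-linear subspace (i.e. any proper subspace of $\mathbb R^{n-1}$ defined over $\mathbb Q$). Then, in the Chabauty topology on closed subsets of $\Gamma\backslash\mathbb H^n$, $\pi_\Gamma(\mathcal I_{s\mathbf v})$ converges to $\Gamma\backslash\mathbb H^n$ as $s\to\infty$.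
   Context: $\mathbb H^n=\{(x_1,\dots,x_n)\in\mathbb R^n:x_n>0\}$ with the hyperbolic metric. The action of $G$ on $\mathbb H^n$ is the following: $G$ acts linearly on $\mathbb I^n=\{(x,y)\in\mathbb R^{n}\times\mathbb R:Q(x,y)=-1,\ y>0\}$, and $\mathbb I^n$ is identified with $\mathbb H^n$ by the composition of $(x_1,\dots,x_n,y)\mapsto\frac{(x_1,\dots,x_n)}{1+y}$ (onto the open unit ball) with $x\mapsto\frac{2(x+e_n)}{\|x+e_n\|^2}-e_n$, where $e_n=(0,\dots,0,1)$; the action of $G$ is transported through this bijection and is isometric. *)

(* Defs.v *)
From HB Require Import structures.
From mathcomp Require Import all_boot all_order all_algebra.
From mathcomp Require Import all_classical all_reals all_analysis.
From mathcomp Require Import generic_quotient ring lra.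

Set Implicit Arguments.
Unset Strict Implicit.
Unset Printing Implicit Defensive.

Import Order.TTheory GRing.Theory Num.Theory.
Import numFieldNormedType.Exports.

Local Open Scope classical_set_scope.
Local Open Scope ring_scope.
Local Open Scope quotient_scope.

(* Vectors are columns.  R^(k+1) is split as R^k x R by usubmx/dsubmx.
   Euclidean norms go through [sqnorm], because the library norm `|x| on
   matrices is the sup norm. *)

Section Forms.
Context {R : realType}.

Definition sqnorm {k} (x : 'cV[R]_k) : R := \sum_i x i 0 ^+ 2.

Definition last_coord {k} (x : 'cV[R]_(k + 1)) : R := dsubmx x 0 0.

Definition quadQ {k} (p : 'cV[R]_(k + 1)) : R :=
  sqnorm (usubmx p) - last_coord p ^+ 2.

End Forms.

Definition SOQ (R : realType) (k : nat) : set 'M[R]_(k + 1) :=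
  [set g | \det g = 1 /\ forall p, quadQ (g *m p) = quadQ p].
Arguments SOQ : clear implicits.

Definition SOQ_Q (R : realType) (k : nat) : set 'M[R]_(k + 1) :=
  SOQ R k `&` [set g | forall i j, range (@ratr R) (g i j)].
Arguments SOQ_Q : clear implicits.

Definition SOQ_Z (R : realType) (k : nat) : set 'M[R]_(k + 1) :=
  SOQ R k `&` [set g | forall i j, g i j \is a Num.int].
Arguments SOQ_Z : clear implicits.

Definition SOQ0 (R : realType) (k : nat) : set 'M[R]_(k + 1) :=
  connected_component (SOQ R k) 1%:M.
Arguments SOQ0 : clear implicits.

Definition hyperboloid (R : realType) (k : nat) : set 'cV[R]_(k + 1) :=
  [set p | quadQ p = -1 /\ 0 < last_coord p].
Arguments hyperboloid : clear implicits.

Definition half_space (R : realType) (m : nat) : set 'cV[R]_(m + 1) :=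
  [set x | 0 < last_coord x].
Arguments half_space : clear implicits.

Section Models.
Context {R : realType}.

Definition ball_of_hyperboloid {k} (p : 'cV[R]_(k + 1)) : 'cV[R]_k :=
  (1 + last_coord p)^-1 *: usubmx p.

Definition hyperboloid_of_ball {k} (b : 'cV[R]_k) : 'cV[R]_(k + 1) :=
  (1 - sqnorm b)^-1 *: col_mx (2 *: b) (1 + sqnorm b)%:M.

Definition last_basis {m} : 'cV[R]_(m + 1) := col_mx 0 1%:M.

(* An involution exchanging the unit ball and the upper half space. *)
Definition ball_half_space {m} (x : 'cV[R]_(m + 1)) : 'cV[R]_(m + 1) :=
  (2 / sqnorm (x + last_basis)) *: (x + last_basis) - last_basis.

Definition to_half_space {m} (p : 'cV[R]_(m + 1 + 1)) : 'cV[R]_(m + 1) :=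
  ball_half_space (ball_of_hyperboloid p).

Definition to_hyperboloid {m} (z : 'cV[R]_(m + 1)) : 'cV[R]_(m + 1 + 1) :=
  hyperboloid_of_ball (ball_half_space z).

Definition half_space_act {m} (g : 'M[R]_(m + 1 + 1)) (z : 'cV[R]_(m + 1)) :=
  to_half_space (g *m to_hyperboloid z).

End Models.

Section ModelsTheory.
Context {R : realType}.

Lemma sqnormZ k a (x : 'cV[R]_k) : sqnorm (a *: x) = a ^+ 2 * sqnorm x.
Proof. by rewrite /sqnorm mulr_sumr; apply: eq_bigr => i _; rewrite mxE exprMn. Qed.

Lemma sqnorm_ge0 k (x : 'cV[R]_k) : 0 <= sqnorm x.
Proof. by apply: sumr_ge0 => i _; exact: sqr_ge0. Qed.

Lemma sqnormE k (x : 'cV[R]_(k + 1)) :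
  sqnorm x = sqnorm (usubmx x) + last_coord x ^+ 2.
Proof.
rewrite /sqnorm /last_coord big_split_ord /= big_ord1 !mxE.
by congr (_ + _); apply: eq_bigr => i _; rewrite mxE.
Qed.

Lemma last_coordD k (x y : 'cV[R]_(k + 1)) :
  last_coord (x + y) = last_coord x + last_coord y.
Proof. by rewrite /last_coord !mxE. Qed.

Lemma last_coordN k (x : 'cV[R]_(k + 1)) : last_coord (- x) = - last_coord x.
Proof. by rewrite /last_coord !mxE. Qed.

Lemma last_coordZ k a (x : 'cV[R]_(k + 1)) :
  last_coord (a *: x) = a * last_coord x.
Proof. by rewrite /last_coord !mxE. Qed.

Lemma last_coord_col k (x : 'cV[R]_k) (a : R) :
  last_coord (col_mx x a%:M) = a.
Proof. by rewrite /last_coord col_mxKd mxE eqxx. Qed.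

Lemma last_coord_basis m : last_coord (last_basis : 'cV[R]_(m + 1)) = 1.
Proof. exact: last_coord_col. Qed.

Lemma usubmxD k (x y : 'cV[R]_(k + 1)) : usubmx (x + y) = usubmx x + usubmx y.
Proof. by apply/matrixP => i j; rewrite !mxE. Qed.

Lemma usubmxZ k a (x : 'cV[R]_(k + 1)) : usubmx (a *: x) = a *: usubmx x.
Proof. by apply/matrixP => i j; rewrite !mxE. Qed.

Lemma col_mx_last k (x : 'cV[R]_(k + 1)) :
  col_mx (usubmx x) (last_coord x)%:M = x.
Proof. by rewrite /last_coord -mx11_scalar vsubmxK. Qed.

Lemma sqnorm_addZbasis m a (x : 'cV[R]_(m + 1)) :
  sqnorm (x + a *: last_basis) = sqnorm x + 2 * a * last_coord x + a ^+ 2.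
Proof.
rewrite !sqnormE usubmxD usubmxZ col_mxKu scaler0 addr0 last_coordD.
by rewrite last_coordZ last_coord_basis; ring.
Qed.

Lemma sqnorm_add_basis m (x : 'cV[R]_(m + 1)) :
  sqnorm (x + last_basis) = sqnorm x + 2 * last_coord x + 1.
Proof. by rewrite -[last_basis]scale1r sqnorm_addZbasis; ring. Qed.

Lemma sqnorm_sub_basis m (x : 'cV[R]_(m + 1)) :
  sqnorm (x - last_basis) = sqnorm x - 2 * last_coord x + 1.
Proof. by rewrite -scaleN1r sqnorm_addZbasis; ring. Qed.

Lemma half_space_sqnorm_gt0 m (x : 'cV[R]_(m + 1)) :
  half_space R m x -> 0 < sqnorm (x + last_basis).
Proof.
rewrite /half_space /= => x0; rewrite sqnorm_add_basis.
by have := sqnorm_ge0 x; lra.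
Qed.

Lemma unit_ball_sqnorm_gt0 m (x : 'cV[R]_(m + 1)) :
  sqnorm x < 1 -> 0 < sqnorm (x + last_basis).
Proof.
move=> x1; rewrite sqnorm_add_basis.
move: x1; rewrite sqnormE; have := sqnorm_ge0 (usubmx x).
by nra.
Qed.

Lemma sqnorm_ball_half_space m (x : 'cV[R]_(m + 1)) :
  0 < sqnorm (x + last_basis) ->
  sqnorm (ball_half_space x) = 1 - 4 * last_coord x / sqnorm (x + last_basis).
Proof.
move=> N0; rewrite /ball_half_space sqnorm_sub_basis sqnormZ last_coordZ.
by rewrite last_coordD last_coord_basis; field; rewrite gt_eqF.
Qed.

Lemma last_ball_half_space m (x : 'cV[R]_(m + 1)) :
  0 < sqnorm (x + last_basis) ->
  last_coord (ball_half_space x) = (1 - sqnorm x) / sqnorm (x + last_basis).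
Proof.
move=> N0; rewrite /ball_half_space last_coordD last_coordN last_coordZ.
rewrite last_coordD !last_coord_basis; apply: (mulIf (lt0r_neq0 N0)).
rewrite divfK ?gt_eqF// mulrBl mul1r mulrAC divfK ?gt_eqF//.
by rewrite sqnorm_add_basis; ring.
Qed.

Lemma ball_half_space_ball m (x : 'cV[R]_(m + 1)) :
  half_space R m x -> sqnorm (ball_half_space x) < 1.
Proof.
move=> x0; have N0 := half_space_sqnorm_gt0 x0.
by rewrite sqnorm_ball_half_space// ltrBlDr ltrDl divr_gt0// mulr_gt0.
Qed.

Lemma ball_half_space_half_space m (x : 'cV[R]_(m + 1)) :
  sqnorm x < 1 -> half_space R m (ball_half_space x).
Proof.
move=> x1; have N0 := unit_ball_sqnorm_gt0 x1.
by rewrite /half_space /= last_ball_half_space// divr_gt0// subr_gt0.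
Qed.

Lemma ball_half_spaceK m (x : 'cV[R]_(m + 1)) :
  0 < sqnorm (x + last_basis) -> ball_half_space (ball_half_space x) = x.
Proof.
move=> N0; rewrite {1}/ball_half_space {1 2}/ball_half_space !subrK sqnormZ.
rewrite scalerA -[_ *: _ - _]/(_ *: _ - _).
set N := sqnorm _ in N0 *; rewrite (_ : _ * _ = 1); last first.
  by field; rewrite gt_eqF.
by rewrite scale1r addrK.
Qed.

Lemma ball_of_hyperboloid_ball k (p : 'cV[R]_(k + 1)) :
  hyperboloid R k p -> 1 - sqnorm (ball_of_hyperboloid p) = 2 / (1 + last_coord p).
Proof.
move=> [Qp y0]; rewrite /ball_of_hyperboloid sqnormZ.
move: Qp; rewrite /quadQ => /eqP; rewrite subr_eq => /eqP ->.
by field; rewrite gt_eqF// addr_gt0.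
Qed.

Lemma hyperboloid_of_ball_hyperboloid k (b : 'cV[R]_k) :
  sqnorm b < 1 -> hyperboloid R k (hyperboloid_of_ball b).
Proof.
move=> b1; have d0 : 0 < 1 - sqnorm b by rewrite subr_gt0.
split; rewrite /quadQ /hyperboloid_of_ball last_coordZ last_coord_col.
  rewrite usubmxZ col_mxKu !sqnormZ; field; by rewrite gt_eqF.
by rewrite mulr_gt0 ?invr_gt0// ltr_wpDr// sqnorm_ge0.
Qed.

Lemma hyperboloid_of_ballK k (b : 'cV[R]_k) :
  sqnorm b < 1 -> ball_of_hyperboloid (hyperboloid_of_ball b) = b.
Proof.
move=> b1; have d0 : 0 < 1 - sqnorm b by rewrite subr_gt0.
rewrite /ball_of_hyperboloid /hyperboloid_of_ball last_coordZ last_coord_col.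
rewrite usubmxZ col_mxKu !scalerA -[RHS]scale1r; congr (_ *: _).
set s := sqnorm b in d0 *; have s1 : 1 - s != 0 by rewrite gt_eqF.
have -> : 1 + (1 - s)^-1 * (1 + s) = 2 / (1 - s) by field.
by field.
Qed.

Lemma ball_of_hyperboloidK k (p : 'cV[R]_(k + 1)) :
  hyperboloid R k p -> hyperboloid_of_ball (ball_of_hyperboloid p) = p.
Proof.
move=> hp; have y0 := hp.2; have y1 : 1 + last_coord p != 0.
  by rewrite gt_eqF// addr_gt0.
have d := ball_of_hyperboloid_ball hp.
have s : sqnorm (ball_of_hyperboloid p) = 1 - 2 / (1 + last_coord p).
  by rewrite -d; ring.
rewrite /hyperboloid_of_ball d s -[RHS]col_mx_last scale_col_mx; congr col_mx.
  rewrite /ball_of_hyperboloid !scalerA -[RHS]scale1r; congr (_ *: _).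
  by field.
by rewrite scale_scalar_mx; congr _%:M; field.
Qed.

Lemma to_half_space_half_space m (p : 'cV[R]_(m + 1 + 1)) :
  hyperboloid R (m + 1) p -> half_space R m (to_half_space p).
Proof.
move=> hp; apply: ball_half_space_half_space.
rewrite -subr_gt0 ball_of_hyperboloid_ball// divr_gt0// addr_gt0//.
exact: hp.2.
Qed.

Lemma to_hyperboloid_hyperboloid m (z : 'cV[R]_(m + 1)) :
  half_space R m z -> hyperboloid R (m + 1) (to_hyperboloid z).
Proof. by move=> hz; exact/hyperboloid_of_ball_hyperboloid/ball_half_space_ball. Qed.

Lemma to_half_spaceK m (p : 'cV[R]_(m + 1 + 1)) :
  hyperboloid R (m + 1) p -> to_hyperboloid (to_half_space p) = p.
Proof.
move=> hp; rewrite /to_hyperboloid /to_half_space ball_half_spaceK.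
  exact: ball_of_hyperboloidK.
apply: unit_ball_sqnorm_gt0.
rewrite -subr_gt0 ball_of_hyperboloid_ball// divr_gt0// addr_gt0//.
exact: hp.2.
Qed.

Lemma to_hyperboloidK m (z : 'cV[R]_(m + 1)) :
  half_space R m z -> to_half_space (to_hyperboloid z) = z.
Proof.
move=> hz; rewrite /to_hyperboloid /to_half_space hyperboloid_of_ballK.
  by rewrite ball_half_spaceK//; exact: half_space_sqnorm_gt0.
exact: ball_half_space_ball.
Qed.

Lemma SOQ_last_coord_neq0 k (g : 'M[R]_(k + 1)) p :
  SOQ R k g -> hyperboloid R k p -> last_coord (g *m p) != 0.
Proof.
move=> [_ gQ] [Qp _]; have := gQ p; rewrite Qp /quadQ => gp.
have := sqnorm_ge0 (usubmx (g *m p)).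
by apply: contraTneq => y0; move: gp; rewrite y0; lra.
Qed.

Lemma mx_entry_continuous (T : topologicalType) k l (i : 'I_k) (j : 'I_l) :
  continuous (fun M : 'M[T]_(k, l) => M i j).
Proof.
move=> M A MA.
exists (fun a b => [set x | a = i -> b = j -> A x]) => [a b|N]; last exact.
have [->|ai] := eqVneq a i; last by apply: filterS filterT => x _ ab; rewrite ab eqxx in ai.
have [->|bj] := eqVneq b j; last by apply: filterS filterT => x _ _ ab; rewrite ab eqxx in bj.
by apply: filterS MA => x Ax _ _.
Qed.

Lemma SOQ0_hyperboloid k (g : 'M[R]_(k + 1)) p :
  SOQ0 R k g -> hyperboloid R k p -> hyperboloid R k (g *m p).
Proof.
move=> g0 hp; have [gd gQ] := connected_component_sub g0.
split; first by rewrite gQ; exact: hp.1.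
pose f (h : 'M[R]_(k + 1)) := last_coord (h *m p).
have cf : continuous f.
  have -> : f = fun h => \sum_j h (rshift k 0) j * p j 0.
    by apply/funext => h; rewrite /f /last_coord !mxE.
  apply: (@continuous_big _ _ _ _ _ (@add_continuous R^o)) => j _ h.
  by apply: cvgMr_tmp; [exact: (nbhs_filter h)|exact: mx_entry_continuous].
have /connected_intervalP itv : connected (f @` SOQ0 R k).
  apply: connected_continuous_connected; first exact: component_connected.
  exact: continuous_subspaceT.
rewrite ltNge; apply/negP => fg0.
have id1 : SOQ R k 1%:M by split=> [|q]; rewrite ?det1 ?mul1mx.
have [] : (f @` SOQ0 R k) 0.
  apply: (itv (f g) (f 1%:M)); first by exists g.
    by exists 1%:M => //; exact: connected_component_refl.
  by rewrite fg0 /f mul1mx ltW//; exact: hp.2.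
move=> h /connected_component_sub hS fh.
by have := SOQ_last_coord_neq0 hS hp; rewrite -/(f h) fh eqxx.
Qed.

Lemma half_space_act_half_space m (g : 'M[R]_(m + 1 + 1)) z :
  SOQ0 R (m + 1) g -> half_space R m z -> half_space R m (half_space_act g z).
Proof.
by move=> g0 hz; exact/to_half_space_half_space/SOQ0_hyperboloid/to_hyperboloid_hyperboloid.
Qed.

Lemma half_space_act1 m (z : 'cV[R]_(m + 1)) :
  half_space R m z -> half_space_act 1%:M z = z.
Proof. by move=> hz; rewrite /half_space_act mul1mx to_hyperboloidK. Qed.

Lemma half_space_actM m (g h : 'M[R]_(m + 1 + 1)) z :
  SOQ0 R (m + 1) h -> half_space R m z ->
  half_space_act g (half_space_act h z) = half_space_act (g *m h) z.
Proof.
move=> h0 hz; rewrite /half_space_act to_half_spaceK ?mulmxA//.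
exact/SOQ0_hyperboloid/to_hyperboloid_hyperboloid.
Qed.

End ModelsTheory.

Record SOQ0_subgroup (R : realType) (k : nat) := SOQ0Subgroup {
  subgroup_carrier :> set 'M[R]_(k + 1);
  subgroup_sub : subgroup_carrier `<=` SOQ0 R k;
  subgroup1 : subgroup_carrier 1%:M;
  subgroupM : forall g h, subgroup_carrier g -> subgroup_carrier h ->
    subgroup_carrier (g *m h);
  subgroupV : forall g, subgroup_carrier g -> subgroup_carrier (invmx g) }.

(* Meaningful when A and B are groups; A need not be contained in B. *)
Definition finite_index (R : realType) (k : nat) (A B : set 'M[R]_k) :=
  finite_set [set [set b *m c | c in A `&` B] | b in B].

Definition commensurable (R : realType) (k : nat) (A B : set 'M[R]_k) :=
  finite_index A B /\ finite_index B A.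

Section OrbitSpace.
Context {R : realType} {m : nat} (Gamma : SOQ0_subgroup R (m + 1)).

Definition same_orbit (z w : half_space R m) : bool :=
  `[< exists2 g, subgroup_carrier Gamma g & half_space_act g (set_val z) = set_val w >].

Lemma same_orbit_refl : reflexive same_orbit.
Proof.
move=> z; apply/asboolP; exists 1%:M; first exact: subgroup1.
exact/half_space_act1/set_valP.
Qed.

Lemma same_orbit_sym : symmetric same_orbit.
Proof.
suff H z w : same_orbit z w -> same_orbit w z by move=> z w; apply/idP/idP; exact: H.
move=> /asboolP[g Gg gz]; apply/asboolP; exists (invmx g); first exact: subgroupV.
have g0 := subgroup_sub Gg; have [gd _] := connected_component_sub g0.
rewrite -gz half_space_actM//; last exact: set_valP.
rewrite mulVmx ?unitmxE ?gd ?unitr1//.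
exact/half_space_act1/set_valP.
Qed.

Lemma same_orbit_trans : transitive same_orbit.
Proof.
move=> w z u /asboolP[g Gg gz] /asboolP[h Gh hw]; apply/asboolP.
exists (h *m g); first exact: subgroupM.
by rewrite -half_space_actM ?gz//; [exact: (subgroup_sub Gg)|exact: set_valP].
Qed.

Canonical same_orbit_equiv :=
  EquivRel same_orbit same_orbit_refl same_orbit_sym same_orbit_trans.

(* The hyperbolic metric of the upper half space model induces on [half_space]
   the subspace topology of R^(m+1), which is the one used here. *)
Definition orbit_space : topologicalType :=
  quotient_topology {eq_quot same_orbit_equiv}.

Definition orbit_proj : half_space R m -> orbit_space :=
  \pi_(quotient_topology {eq_quot same_orbit_equiv}).

End OrbitSpace.

Section Chabauty.
Context {X : topologicalType}.

Record closed_set := ClosedSet {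
  closed_set_carrier :> set X;
  closed_set_closed : closed closed_set_carrier }.

HB.instance Definition _ := gen_eqMixin closed_set.
HB.instance Definition _ := gen_choiceMixin closed_set.

Definition chabauty_subbase : set (set closed_set) :=
  [set O | (exists2 K : set X, compact K &
              O = [set F : closed_set | F `&` K = set0])
        \/ (exists2 U : set X, open U &
              O = [set F : closed_set | F `&` U !=set0])].

HB.instance Definition _ :=
  isSubBaseTopological.Build closed_set chabauty_subbase id.

End Chabauty.
Arguments closed_set X : clear implicits.

(* The ray {t (w, 1) : t > 0}, as a subset of the half space. *)
Definition half_space_ray (R : realType) (m : nat) (w : 'cV[R]_m) :
    set (half_space R m) :=
  [set z | exists2 t : R, 0 < t & set_val z = t *: col_mx w 1%:M].

(* Main.v *)
Require Import Defs.
From HB Require Import structures.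
From mathcomp Require Import all_boot all_order all_algebra.
From mathcomp Require Import all_classical all_reals all_analysis.
From mathcomp Require Import generic_quotient ring lra zify.

(** The two ends infinity and [0] of the rays correspond to rational light vectors,
    so they are cusps of [Gamma], and everything can be seen from the cusp at
    infinity.

    Convergence. A neighbourhood of the full set in the Chabauty topology is
    described by finitely many open sets that must be met, since no nonempty
    compact set is avoided by the full set. [Gamma] contains the horizontal
    translations by a lattice [D Z^m] ([commensurable_translations]): among the
    integral unipotent matrices along each axis two lie in the same coset of
    a subgroup of finite index. Modulo this lattice, the part of the ray of
    direction [s *: v] at heights close to [t0] projects horizontally to a line
    segment of direction [v] whose length grows with [s]. The genericity of [v] says
    that its coordinates are independent over [Z], so by Kronecker's theorem in
    the uniform form [Kronecker_uniform] such a segment comes close to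
    every point of the torus. Hence a point at height about [t0] is
    approached by translates of the ray ([orbit_ray_meets_open]). Kronecker's theorem
    is proved by induction on the dimension from Dirichlet's approximation.

    Closedness. In the hyperboloid model a ray is the set of points with given first
    [m] coordinates ([half_space_rayE]), and going to either end means that the
    product with one of the two light vectors tends to [0]. The elements
    of [Gamma] have a common denominator ([commensurable_denominator]), so the images
    of these light vectors have last coordinate bounded away from [0], and
    so are their products with a point [q] of a bounded region
    ([light_lower_bound]). Therefore an element of [Gamma] that brings [q] onto the ray
    brings it to a bounded part of the ray, has bounded entries, and belongs
    to a finite set. Locally the preimage of the projected ray is thus a finite union
    of closed sets ([closed_orbit_ray]). *)

Set Implicit Arguments.
Unset Strict Implicit.
Unset Printing Implicit Defensive.

Import Order.TTheory GRing.Theory Num.Theory.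
Import numFieldNormedType.Exports.

Local Open Scope classical_set_scope.
Local Open Scope ring_scope.

(** * Kronecker's theorem *)

Section Kronecker.
Context {R : realType}.

(** Vectors are sequences of which only the first [m] terms matter, so that the
    induction on [m] needs no change of index type. *)
Definition Z_independent (m : nat) (v : nat -> R) :=
  forall k : nat -> int, \sum_(i < m) (k i)%:~R * v i = 0 ->
    forall i, (i < m)%N -> k i = 0.

(** The torus [R^m / Z^m] is cut into [N.+1 ^ m] cubes of side [N.+1%:R^-1]; this
    is the one that contains [x]. *)
Definition cell N m (x : nat -> R) : {ffun 'I_m -> 'I_N.+1} :=
  [ffun i : 'I_m =>
     inord (Num.truncn (N.+1%:R * (x i - (Num.floor (x i))%:~R)))].

Lemma cell_close N m (x y : nat -> R) : cell N m x = cell N m y ->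
  forall i, (i < m)%N ->
  `|x i - y i - (Num.floor (x i) - Num.floor (y i))%:~R| < N.+1%:R^-1.
Proof.
move=> /ffunP xy i im; have := xy (Ordinal im); rewrite !ffunE /=.
have frac (z : R) : 0 <= z - (Num.floor z)%:~R < 1.
  by have := floor_le z; have := floorD1_gt z; rewrite intrD => *; lra.
have trunc (z : R) : 0 <= z < 1 ->
    (Num.truncn (N.+1%:R * z))%:R <= N.+1%:R * z < (Num.truncn (N.+1%:R * z))%:R + 1
    /\ (Num.truncn (N.+1%:R * z) < N.+1)%N.
  move=> /andP[z0 z1]; have Nz : 0 <= N.+1%:R * z by rewrite mulr_ge0.
  have := truncn_itv Nz; set tr := Num.truncn _; rewrite -[tr.+1%:R]natr1 => tz; split; first exact: tz.
  rewrite -(ltr_nat R); have /andP[tl _] := tz.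
  by apply: (le_lt_trans tl); rewrite -[ltRHS]mulr1 ltr_pM2l.
have [tx lx] := trunc _ (frac (x i)); have [ty ly] := trunc _ (frac (y i)).
move=> /(congr1 (@nat_of_ord _)); rewrite !inordK// => e.
rewrite e in tx; rewrite -[ltRHS]mul1r ltr_pdivlMr ?ltr0n//.
set n := (N.+1%:R : R) in tx ty *; have n0 : 0 <= n by rewrite ler0n.
rewrite -(ger0_norm n0) -normrM ltr_norml intrB.
set fx := (Num.floor (x i))%:~R in tx *; set fy := (Num.floor (y i))%:~R in ty *.
set t := (_%:R : R) in tx ty.
move: tx ty => /andP[? ?] /andP[? ?].
have -> : (x i - y i - (fx - fy)) * n = n * (x i - fx) - n * (y i - fy) by ring.
by apply/andP; split; lra.
Qed.

Lemma exists_inv_lt (eps : R) : 0 < eps -> exists N, N.+1%:R^-1 < eps.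
Proof.
move=> e0; exists (Num.truncn eps^-1).
by rewrite invf_plt ?posrE ?ltr0n// truncnS_gt.
Qed.

(** There are more multiples of [theta] than cells, so two of them share a cell. *)
Lemma Dirichlet_approximation m (theta : nat -> R) (eps : R) : 0 < eps ->
  exists q : nat, exists b : nat -> int, (0 < q)%N /\
    forall i, (i < m)%N -> `|q%:R * theta i - (b i)%:~R| < eps.
Proof.
move=> /exists_inv_lt[N Ne].
pose c (n : 'I_(#|{ffun 'I_m -> 'I_N.+1}|.+1)) : {ffun 'I_m -> 'I_N.+1} :=
  cell N m (fun i => n%:R * theta i).
have [a [b ab cab]] : exists a, exists2 b, a != b & c a = c b.
  by apply/injectivePn/negP => /injectiveP/leq_card; rewrite card_ord ltnn.
wlog ltba : a b ab cab / (b < a)%N.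
  move=> H; have [ltba|leab] := ltnP b a; first exact: (H a b).
  by apply: (H b a) => //; [rewrite eq_sym|rewrite ltn_neqAle leab andbT].
exists (a - b)%N.
exists (fun i => Num.floor (a%:R * theta i) - Num.floor (b%:R * theta i)).
split; first by rewrite subn_gt0.
move=> i im; rewrite natrB ?(ltnW ltba)// mulrBl.
exact: lt_trans (cell_close cab im) Ne.
Qed.

Definition line_dense (m : nat) (v : nat -> R) :=
  forall (x : nat -> R) (eps : R), 0 < eps -> exists tau : R, exists b : nat -> int,
    forall i, (i < m)%N -> `|tau * v i - x i - (b i)%:~R| < eps.

(** When [1, theta 0, ..., theta (m - 1)] are independent over [Z], a Dirichlet
    approximation [phi = q theta - b] has independent coordinates, so its line is
    dense modulo [Z^m]; as [phi] is short, its integer multiples follow that line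
    closely. *)
Lemma multiples_dense m (theta : nat -> R) :
  (forall v, Z_independent m v -> line_dense m v) ->
  (forall (k : nat -> int) (l : int),
     \sum_(i < m) (k i)%:~R * theta i = l%:~R -> forall i, (i < m)%N -> k i = 0) ->
  forall (x : nat -> R) (eps : R), 0 < eps -> exists n : int, exists b : nat -> int,
    forall i, (i < m)%N -> `|n%:~R * theta i - x i - (b i)%:~R| < eps.
Proof.
move=> IH ind x eps e0; have e20 : 0 < eps / 2 by rewrite divr_gt0.
have [q [b [q0 qb]]] := Dirichlet_approximation m theta e20.
pose phi i := q%:R * theta i - (b i)%:~R.
have phi_ind : Z_independent m phi.
  move=> k /eqP; rewrite /phi.
  under eq_bigr do rewrite mulrBr.
  rewrite sumrB subr_eq0 => /eqP e i im.
  have /(_ i im)/eqP : forall i, (i < m)%N -> q%:Z * k i = 0.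
    apply: (ind (fun i => q%:Z * k i) (\sum_(i < m) k i * b i)).
    rewrite rmorph_sum /=; under [RHS]eq_bigr do rewrite intrM.
    by rewrite -e; apply: eq_bigr => j _; rewrite intrM -pmulrn; ring.
  by rewrite mulf_eq0 => /orP[/eqP|/eqP//]; case: (q) q0.
have [tau [c tc]] := IH _ phi_ind x _ e20.
exists (Num.floor tau * q%:Z), (fun i => Num.floor tau * b i + c i) => i im.
have := qb i im; have := tc i im; rewrite -/(phi i) => H1 H2.
have -> : (Num.floor tau * q%:Z)%:~R * theta i - x i
    - (Num.floor tau * b i + c i)%:~R =
    (tau * phi i - x i - (c i)%:~R) - (tau - (Num.floor tau)%:~R) * phi i.
  by rewrite /phi intrD !intrM -pmulrn; ring.
rewrite (splitr eps); apply: le_lt_trans (ler_normB _ _) _; apply: ltrD => //.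
apply: le_lt_trans H2; rewrite normrM ler_piMl// ler_norml.
by have := floor_le tau; have := floorD1_gt tau; rewrite intrD => *; lra.
Qed.

(** Kronecker's theorem, by induction on [m]: where the last coordinate of the line is
    prescribed modulo [1], the others form a coset of the integer multiples of a
    vector of [R^m], to which [multiples_dense] applies. *)
Lemma Kronecker_line m (v : nat -> R) : Z_independent m v -> line_dense m v.
Proof.
elim: m v => [|m IH] v ind; first by move=> x eps _; exists 0, (fun=> 0).
have vm0 : v m != 0.
  apply/negP => /eqP vm0.
  suff : (if m == m then 1 else 0 : int) = 0 by rewrite eqxx.
  apply: (ind (fun i => if i == m then 1 else 0)) => //.
  rewrite big1// => i _; case: ifP => [/eqP->|_]; by rewrite ?vm0 ?mulr0 ?mul0r.
pose theta i := v i / v m.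
have theta_ind (k : nat -> int) (l : int) :
    \sum_(i < m) (k i)%:~R * theta i = l%:~R -> forall i, (i < m)%N -> k i = 0.
  move=> e i im; pose k' j := if j == m then - l else k j.
  have k'E j : (j < m)%N -> k' j = k j by rewrite /k' => jm; rewrite ltn_eqF.
  rewrite -k'E//; apply: ind => //; last by rewrite ltnS ltnW.
  rewrite big_ord_recr /= {2}/k' eqxx mulrNz mulNr -e mulr_suml.
  apply/eqP; rewrite subr_eq0; apply/eqP; apply: eq_bigr => j _.
  by rewrite k'E// /theta -mulrA divfK.
move=> x eps e0.
have [n [b nb]] := multiples_dense IH theta_ind (fun i => x i - x m * theta i) e0.
exists ((x m + n%:~R) / v m), (fun i => if i == m then n else b i) => i.
rewrite ltnS leq_eqVlt; case: eqVneq => [-> _|_ /= im].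
  by rewrite divfK// [x m + _]addrC addrK subrr normr0.
apply: le_lt_trans (nb i im); rewrite le_eqVlt; apply/orP; left; apply/eqP.
by congr (`|_ - _|); rewrite /theta; ring.
Qed.

(** Finitely many targets represent all targets up to [eps], so the time needed
    to approach a target is bounded; translating the target along the line then
    allows an arbitrary starting time. *)
Lemma Kronecker_uniform m (v : nat -> R) (eps : R) : Z_independent m v -> 0 < eps ->
  exists2 l : R, 0 <= l & forall (x : nat -> R) (T : R),
    exists2 tau, T <= tau <= T + l & exists b : nat -> int,
      forall i, (i < m)%N -> `|tau * v i - x i - (b i)%:~R| < eps.
Proof.
move=> /Kronecker_line dense e0.
have e20 : 0 < eps / 2 by rewrite divr_gt0.
have [N Ne] := exists_inv_lt e20.
pose near (y : nat -> R) (tau : R) := exists b : nat -> int, forall i, (i < m)%N ->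
  `|tau * v i - y i - (b i)%:~R| < eps.
have cell_time (f : {ffun 'I_m -> 'I_N.+1}) :
    exists tau, forall y, cell N m y = f -> near y tau.
  have [[y0 y0f]|no] := pselect (exists y, cell N m y = f); last first.
    by exists 0 => y yf; case: no; exists y.
  have [tau [b tb]] := dense y0 _ e20; exists tau => y yf.
  exists (fun i => b i - (Num.floor (y i) - Num.floor (y0 i))) => i im.
  have /cell_close/(_ i im) H : cell N m y = cell N m y0 by rewrite yf.
  have -> : tau * v i - y i - (b i - (Num.floor (y i) - Num.floor (y0 i)))%:~R
    = (tau * v i - y0 i - (b i)%:~R)
      - (y i - y0 i - (Num.floor (y i) - Num.floor (y0 i))%:~R).
    by rewrite [(b i - _)%:~R]intrB; ring.
  rewrite (splitr eps); apply: le_lt_trans (ler_normB _ _) _.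
  by apply: ltrD; [exact: tb|exact: lt_trans H Ne].
have [t tP] := choice cell_time.
pose M := \sum_f `|t f|.
have tM f : `|t f| <= M.
  by rewrite /M (bigD1 f)//= lerDl sumr_ge0.
have M0 : 0 <= M by rewrite sumr_ge0.
exists (M + M) => [|x T]; first by rewrite addr_ge0.
pose y i := x i - (T + M) * v i.
have [b yb] := tP _ y erefl.
exists (T + M + t (cell N m y)).
  by have := tM (cell N m y); rewrite ler_norml => /andP[? ?]; apply/andP; split; lra.
exists b => i im; have := yb i im; rewrite /y.
by congr (`|_ - _| < _); ring.
Qed.

End Kronecker.

(** * The Lorentz form and the models of hyperbolic space *)

Section Lorentz.
Context {R : realType}.

Definition dot {k} (x y : 'cV[R]_k) : R := \sum_i x i 0 * y i 0.

Definition lorentz {k} (p q : 'cV[R]_(k + 1)) : R :=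
  dot (usubmx p) (usubmx q) - last_coord p * last_coord q.

Lemma dotDl k (x y z : 'cV[R]_k) : dot (x + y) z = dot x z + dot y z.
Proof. by rewrite /dot -big_split; apply: eq_bigr => i _; rewrite mxE mulrDl. Qed.

Lemma dotZl k a (x y : 'cV[R]_k) : dot (a *: x) y = a * dot x y.
Proof. by rewrite /dot mulr_sumr; apply: eq_bigr => i _; rewrite mxE mulrA. Qed.

Lemma dotC k (x y : 'cV[R]_k) : dot x y = dot y x.
Proof. by apply: eq_bigr => i _; rewrite mulrC. Qed.

Lemma dotxx k (x : 'cV[R]_k) : dot x x = sqnorm x.
Proof. by apply: eq_bigr => i _; rewrite expr2. Qed.

Lemma dot0l k (x : 'cV[R]_k) : dot 0 x = 0.
Proof. by rewrite -(scale0r 0) dotZl mul0r. Qed.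

Lemma dot_mulmx k (x y : 'cV[R]_k) : x^T *m y = (dot x y)%:M.
Proof.
rewrite [LHS]mx11_scalar; congr _%:M; rewrite mxE.
by apply: eq_bigr => i _; rewrite mxE.
Qed.

Lemma dot_split k (x y : 'cV[R]_(k + 1)) :
  dot x y = dot (usubmx x) (usubmx y) + last_coord x * last_coord y.
Proof.
rewrite /dot /last_coord big_split_ord /= big_ord1 !mxE.
by congr (_ + _); apply: eq_bigr => i _; rewrite !mxE.
Qed.

Lemma sqnormD k (x y : 'cV[R]_k) :
  sqnorm (x + y) = sqnorm x + 2 * dot x y + sqnorm y.
Proof. by rewrite -!dotxx !(dotDl, dotC _ (x + y)) (dotC y x); ring. Qed.

Lemma dot_CauchySchwarz k (x y : 'cV[R]_k) :
  dot x y ^+ 2 <= sqnorm x * sqnorm y.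
Proof.
(* The sum is [sqnorm (c *: x + d *: y)]. *)
have H c d : 0 <= c ^+ 2 * sqnorm x + 2 * (c * d) * dot x y + d ^+ 2 * sqnorm y.
  have := sqnorm_ge0 (c *: x + d *: y).
  rewrite sqnormD !sqnormZ dotZl (dotC x) dotZl (dotC y).
  by congr (0 <= _); ring.
have := sqnorm_ge0 y; rewrite le_eqVlt => /orP[/eqP y0|y0].
  have [->|xy0] := eqVneq (dot x y) 0; first by rewrite -y0 expr0n mulr0.
  (* This value of [d] would make the form [H] equal to [-1]. *)
  have := H 1 (- (sqnorm x + 1) / (2 * dot x y)); rewrite -y0.
  have -> : 1 ^+ 2 * sqnorm x + 2 * (1 * (- (sqnorm x + 1) / (2 * dot x y))) * dot x y
    + (- (sqnorm x + 1) / (2 * dot x y)) ^+ 2 * 0 = -1 by field.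
  by lra.
have := H (sqnorm y) (- dot x y).
have -> : sqnorm y ^+ 2 * sqnorm x + 2 * (sqnorm y * - dot x y) * dot x y
    + (- dot x y) ^+ 2 * sqnorm y
  = sqnorm y * (sqnorm x * sqnorm y - dot x y ^+ 2) by ring.
by rewrite pmulr_rge0// subr_ge0.
Qed.

Lemma sqnorm_eq0 k (x : 'cV[R]_k) : sqnorm x = 0 -> x = 0.
Proof.
move=> /eqP; rewrite psumr_eq0 => [/allP x0|i _]; last exact: sqr_ge0.
apply/matrixP => i j; rewrite (ord1 j) mxE; apply/eqP.
by have := x0 i (mem_index_enum _); rewrite sqrf_eq0.
Qed.

Lemma sqr_coord_le_sqnorm k (x : 'cV[R]_k) i : x i 0 ^+ 2 <= sqnorm x.
Proof.
by rewrite /sqnorm (bigD1 i)//= lerDl sumr_ge0// => j _; exact: sqr_ge0.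
Qed.

Lemma lorentzDl k (p q r : 'cV[R]_(k + 1)) :
  lorentz (p + q) r = lorentz p r + lorentz q r.
Proof. by rewrite /lorentz usubmxD last_coordD dotDl; ring. Qed.

Lemma lorentzZl k a (p q : 'cV[R]_(k + 1)) : lorentz (a *: p) q = a * lorentz p q.
Proof. by rewrite /lorentz usubmxZ last_coordZ dotZl; ring. Qed.

Lemma lorentzC k (p q : 'cV[R]_(k + 1)) : lorentz p q = lorentz q p.
Proof. by rewrite /lorentz dotC mulrC. Qed.

Lemma lorentzDr k (p q r : 'cV[R]_(k + 1)) :
  lorentz r (p + q) = lorentz r p + lorentz r q.
Proof. by rewrite !(lorentzC r) lorentzDl. Qed.

Lemma lorentzZr k a (p q : 'cV[R]_(k + 1)) : lorentz q (a *: p) = a * lorentz q p.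
Proof. by rewrite !(lorentzC q) lorentzZl. Qed.

Lemma lorentzxx k (p : 'cV[R]_(k + 1)) : lorentz p p = quadQ p.
Proof. by rewrite /lorentz dotxx -expr2. Qed.

Lemma quadQD k (p q : 'cV[R]_(k + 1)) :
  quadQ (p + q) = quadQ p + 2 * lorentz p q + quadQ q.
Proof. by rewrite /quadQ usubmxD last_coordD sqnormD /lorentz; ring. Qed.

Lemma quadQZ k a (p : 'cV[R]_(k + 1)) : quadQ (a *: p) = a ^+ 2 * quadQ p.
Proof. by rewrite /quadQ usubmxZ last_coordZ sqnormZ; ring. Qed.

Lemma SOQ_lorentz k (g : 'M[R]_(k + 1)) p q :
  SOQ R k g -> lorentz (g *m p) (g *m q) = lorentz p q.
Proof.
move=> [_ gQ]; have := gQ (p + q); rewrite mulmxDr !quadQD !gQ; lra.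
Qed.

(** For [p] in a bounded part of the hyperboloid, [lorentz _ p] is bounded below by
    the last coordinate on light vectors ([kappa = 0]), and controls the size
    of unit vectors ([kappa = 1]): by Cauchy-Schwarz the spatial part of [p] is
    shorter than its last coordinate [y], by at least [1 / (2 * y)]. *)
Lemma last_coord_bound k (kappa : R) (a p : 'cV[R]_(k + 1)) :
  0 <= kappa -> quadQ a <= kappa ^+ 2 -> hyperboloid R k p ->
  `|last_coord a| <=
    2 * last_coord p * (`|lorentz a p| + kappa * last_coord p).
Proof.
move=> k0 Qa [Qp y0]; rewrite /quadQ in Qa Qp.
have := dot_CauchySchwarz (usubmx a) (usubmx p).
move: (sqnorm_ge0 (usubmx a)) (sqnorm_ge0 (usubmx p)) Qa Qp.
rewrite /lorentz; set d := dot _ _; set y := last_coord p in y0 *.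
set c := last_coord a; rewrite -(real_normK (num_real c)).
set A := sqnorm _; set P := sqnorm _; move=> A0 P0 Qa Qp CS.
set r := Num.sqrt P; set e := `|d - c * y|.
have r0 : 0 <= r by exact: sqrtr_ge0.
have rP : r ^+ 2 = P by rewrite sqr_sqrtr.
have ry : r <= y by rewrite -(ler_pXn2r (n := 2))// ?nnegrE ?(ltW y0)// rP; lra.
have dn : `|d| <= (`|c| + kappa) * r.
  rewrite -(ler_pXn2r (n := 2))// ?nnegrE ?mulr_ge0 ?addr_ge0//.
  rewrite real_normK ?num_real// (le_trans CS)// exprMn rP ler_wpM2r//.
  by have := mulr_ge0 (normr_ge0 c) k0; rewrite sqrrD; lra.
have cy : `|c| * y <= e + `|d|.
  rewrite -[X in _ * X](gtr0_norm y0) -normrM.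
  have -> : c * y = d - (d - c * y) by ring.
  by rewrite (le_trans (ler_normB _ _))// addrC.
have c0 := normr_ge0 c.
have step : `|c| * (y - r) <= e + kappa * r by lra.
have ek : 0 <= e + kappa * r by rewrite addr_ge0 ?mulr_ge0// normr_ge0.
(* [y ^+ 2 - r ^+ 2 = 1] on the hyperboloid. *)
have -> : `|c| = `|c| * (y - r) * (y + r).
  by rewrite -mulrA (_ : (y - r) * (y + r) = 1) ?mulr1//; lra.
have yr : 0 <= y + r by lra.
apply: (le_trans (ler_wpM2r yr step)).
have kr : kappa * r <= kappa * y by exact: ler_wpM2l.
rewrite mulrC ler_pM//; lra.
Qed.

Lemma coord_bound k (a : 'cV[R]_(k + 1)) i :
  quadQ a <= 1 -> `|a i 0| <= 1 + 2 * `|last_coord a|.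
Proof.
rewrite /quadQ => Qa; have := sqr_coord_le_sqnorm a i; rewrite sqnormE => ai.
have c0 := normr_ge0 (last_coord a).
rewrite -(ler_pXn2r (n := 2))// ?nnegrE//.
rewrite real_normK ?num_real//; move: Qa ai.
rewrite -(real_normK (num_real (last_coord a))); move: c0.
set c := `|last_coord a| => c0 Qa ai; have c20 := sqr_ge0 c.
by rewrite sqrrD exprMn; lra.
Qed.

Lemma lorentz_bound k (e q : 'cV[R]_(k + 1)) :
  sqnorm e <= 1 -> hyperboloid R k q -> `|lorentz e q| <= 2 * last_coord q.
Proof.
move=> e1 [Qq y0]; move: Qq e1; rewrite /quadQ /lorentz (sqnormE e) => Qq e1.
have := dot_CauchySchwarz (usubmx e) (usubmx q).
move: (sqnorm_ge0 (usubmx e)) (sqnorm_ge0 (usubmx q)) Qq e1.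
set d := dot _ _; set y := last_coord q in y0 *; set c := last_coord e.
set E := sqnorm _; set P := sqnorm _ => E0 P0 Qq e1 CS.
have c20 := sqr_ge0 c.
have dy : `|d| <= y.
  rewrite -(ler_pXn2r (n := 2))// ?nnegrE ?(ltW y0)// real_normK ?num_real//.
  by apply: (le_trans CS); nra.
have cy : `|c * y| <= y.
  rewrite normrM (gtr0_norm y0) ler_piMl ?(ltW y0)//.
  rewrite -(ler_pXn2r (n := 2))// ?nnegrE// real_normK ?num_real//; lra.
by apply: (le_trans (ler_normB _ _)); lra.
Qed.

(** The points [-last_basis] and [last_basis] of the unit sphere, which correspond
    to the ends infinity and [0] of the half space, give the light vectors
    [light (-1)] and [light 1]. *)
Definition light {m} (c : R) : 'cV[R]_(m + 1 + 1) := col_mx (c *: last_basis) 1%:M.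

Lemma last_light m c : last_coord (light c : 'cV[R]_(m + 1 + 1)) = 1.
Proof. exact: last_coord_col. Qed.

Lemma lorentz_light m c (p : 'cV[R]_(m + 1 + 1)) :
  lorentz (light c) p = c * last_coord (usubmx p) - last_coord p.
Proof.
rewrite /lorentz last_light mul1r /light col_mxKu dotZl; congr (_ * _ - _).
by rewrite dot_split /last_basis col_mxKu dot0l add0r last_coord_col mul1r.
Qed.

Lemma quadQ_light m c : quadQ (light c : 'cV[R]_(m + 1 + 1)) = c ^+ 2 - 1.
Proof.
rewrite -lorentzxx lorentz_light last_light {1}/light col_mxKu.
by rewrite last_coordZ last_coord_basis; ring.
Qed.

(** In other words, a point at height [t] has [y + x_n = 1 / t] and
    [y - x_n = sqnorm z / t]: these quantities, which are up to sign the products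
    with the two light vectors, tell how deep the point is in the cusps infinity
    and [0]. *)
Lemma to_hyperboloidE m (z : 'cV[R]_(m + 1)) : half_space R m z ->
  to_hyperboloid z =
  col_mx (col_mx ((last_coord z)^-1 *: usubmx z)
                 ((1 - sqnorm z) / (2 * last_coord z))%:M)
         ((1 + sqnorm z) / (2 * last_coord z))%:M.
Proof.
move=> hz; have N0 := half_space_sqnorm_gt0 hz.
have t0 : last_coord z != 0 by rewrite gt_eqF.
have Nn : sqnorm (z + last_basis) != 0 by rewrite gt_eqF.
rewrite /to_hyperboloid /hyperboloid_of_ball sqnorm_ball_half_space//.
set N := sqnorm (z + last_basis) in N0 Nn *; set t := last_coord z in t0 *.
have NE : N = sqnorm z + 2 * t + 1 by exact: sqnorm_add_basis.
have tn : 4 * t != 0 by rewrite mulf_neq0.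
have -> : (1 - (1 - 4 * t / N))^-1 = N / (4 * t) by rewrite subKr invf_div.
rewrite scale_col_mx scale_scalar_mx; congr col_mx; last first.
  congr _%:M; rewrite (_ : sqnorm z = N - 2 * t - 1); last by rewrite NE; ring.
  by field; rewrite Nn t0.
rewrite -[LHS]col_mx_last; congr col_mx.
  have uB : usubmx last_basis = 0 :> 'cV[R]_m by rewrite /last_basis col_mxKu.
  rewrite /ball_half_space !usubmxZ usubmxD usubmxZ -scaleN1r usubmxZ usubmxD.
  rewrite uB scaler0 !addr0 !scalerA -/N; congr (_ *: _).
  by field; rewrite Nn t0.
rewrite !last_coordZ last_ball_half_space// -/N; congr _%:M.
by field; rewrite Nn t0.
Qed.

(** The first [m] coordinates of the point of the hyperboloid are those of [z] divided
    by its height. *)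
Lemma half_space_rayE m (w : 'cV[R]_m) (z : half_space R m) :
  half_space_ray w z <-> usubmx (usubmx (to_hyperboloid (set_val z))) = w.
Proof.
have hz : half_space R m (set_val z) := set_valP z.
rewrite to_hyperboloidE// !col_mxKu; split => [[t t0 ->]|].
  rewrite usubmxZ col_mxKu last_coordZ last_coord_col mulr1 scalerA.
  by rewrite mulVf ?gt_eqF// scale1r.
move=> <-; exists (last_coord (set_val z)); first exact: hz.
rewrite scale_col_mx scalerA divff ?gt_eqF// scale1r scale_scalar_mx mulr1.
by rewrite col_mx_last.
Qed.

(** Along the curve where the first [m] coordinates equal [w] one has
    [(y - x_n) * (y + x_n) = 1 + sqnorm w], so lower bounds on the two factors
    bound [y]. *)
Lemma ray_last_coord_bound m (w : 'cV[R]_m) (p : 'cV[R]_(m + 1 + 1)) (d : R) :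
  hyperboloid R (m + 1) p -> usubmx (usubmx p) = w -> 0 < d ->
  d <= `|lorentz (light 1) p| -> d <= `|lorentz (light (-1)) p| ->
  last_coord p <= (1 + sqnorm w) / d.
Proof.
move=> [Qp y0] pw d0; rewrite !lorentz_light.
move: Qp; rewrite /quadQ sqnormE pw mul1r mulN1r.
set x := last_coord (usubmx p); set y := last_coord p in y0 *.
move=> Qp; have W0 := sqnorm_ge0 w.
have xy : `|x| < y by rewrite -(ltr_pXn2r (n := 2))// ?nnegrE ?(ltW y0)// real_normK ?num_real//; lra.
move: xy; rewrite ltr_norml => /andP[x1 x2].
rewrite ler0_norm ?subr_le0 ?(ltW x2)// ler0_norm; last by lra.
move=> d1 d2; rewrite ler_pdivlMr//.
have : 0 <= (y - x - d) * (y + x) by apply: mulr_ge0; lra.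
have : 0 <= (- (- x - y) - d) * (y - x) by apply: mulr_ge0; lra.
lra.
Qed.

End Lorentz.

(** * Horizontal translations *)

Section Translations.
Context {R : realType}.

Lemma eq_mulmx_cV k l (A B : 'M[R]_(k, l)) :
  (forall x : 'cV_l, A *m x = B *m x) -> A = B.
Proof.
move=> AB; apply/matrixP => i j.
by have /colP/(_ i) := AB (delta_mx j 0); rewrite -!colE !mxE.
Qed.

Definition lorentz_row {k} (p : 'cV[R]_(k + 1)) : 'rV[R]_(k + 1) :=
  row_mx (usubmx p)^T (- last_coord p)%:M.

Lemma lorentz_rowE k (p q : 'cV[R]_(k + 1)) :
  lorentz_row p *m q = (lorentz p q)%:M.
Proof.
rewrite -{1}(col_mx_last q) mul_row_col dot_mulmx -scalar_mxM.
by rewrite -raddfD /= mulNr.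
Qed.

(** The Gram matrix [J] of the form satisfies [g^T J g = J]. *)
Lemma det_isometry k (g : 'M[R]_(k + 1)) :
  (forall p, quadQ (g *m p) = quadQ p) -> \det g ^+ 2 = 1.
Proof.
move=> gQ; pose J : 'M[R]_(k + 1) := block_mx 1%:M 0 0 (-1)%:M.
have JE p : p^T *m J = lorentz_row p.
  rewrite -{1}(col_mx_last p) tr_col_mx mul_row_block !mulmx0 mulmx1 addr0 add0r.
  by rewrite tr_scalar_mx -scalar_mxM mulrN1.
have glor p q : lorentz (g *m p) (g *m q) = lorentz p q.
  by have := gQ (p + q); rewrite mulmxDr !quadQD !gQ; lra.
have gJ : g^T *m J *m g = J.
  apply: eq_mulmx_cV => q; apply: trmx_inj; apply: eq_mulmx_cV => p.
  apply: trmx_inj; rewrite !trmx_mul !trmxK !mulmxA -trmx_mul !JE -mulmxA.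
  by rewrite !lorentz_rowE glor.
have J0 : \det J != 0 by rewrite det_ublock !det_scalar expr1n mul1r expr1 oppr_eq0 oner_eq0.
have := congr1 determinant gJ; rewrite !det_mulmx det_tr => e.
by apply: (mulIf J0); rewrite mul1r -[RHS]e; ring.
Qed.

(** The horizontal direction [a], as a vector orthogonal to both light vectors. *)
Definition tangent {m} (a : 'cV[R]_m) : 'cV[R]_(m + 1 + 1) := col_mx (col_mx a 0) 0.

Lemma lorentz_tangent m (a : 'cV[R]_m) p :
  lorentz (tangent a) p = dot a (usubmx (usubmx p)).
Proof.
rewrite /lorentz /tangent col_mxKu dot_split !col_mxKu /last_coord !col_mxKd.
by rewrite !mxE !mul0r subr0 addr0.
Qed.

Lemma tangentD m (a b : 'cV[R]_m) : tangent (a + b) = tangent a + tangent b.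
Proof. by rewrite /tangent !add_col_mx !addr0. Qed.

Lemma quadQ_tangent m (a : 'cV[R]_m) : quadQ (tangent a) = sqnorm a.
Proof. by rewrite -lorentzxx lorentz_tangent /tangent !col_mxKu dotxx. Qed.

Lemma lorentz_light_tangent m (c : R) (a : 'cV[R]_m) : lorentz (light c) (tangent a) = 0.
Proof.
by rewrite lorentzC lorentz_tangent /light !(col_mxKu, usubmxZ) scaler0 dotC dot0l.
Qed.

Lemma lorentz_tangent_light m (c : R) (a : 'cV[R]_m) : lorentz (tangent a) (light c) = 0.
Proof. by rewrite lorentzC lorentz_light_tangent. Qed.

(** The unipotent isometry (Eichler transformation) that fixes [light (-1)] and
    corresponds to the translation of the half space by [col_mx a 0]. *)
Definition translation {m} (a : 'cV[R]_m) : 'M[R]_(m + 1 + 1) :=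
  1%:M - tangent a *m lorentz_row (light (-1))
  + light (-1) *m (lorentz_row (tangent a) - (sqnorm a / 2) *: lorentz_row (light (-1))).

Lemma translationE m (a : 'cV[R]_m) p :
  translation a *m p = p - lorentz (light (-1)) p *: tangent a
    + (lorentz (tangent a) p - sqnorm a / 2 * lorentz (light (-1)) p) *: light (-1).
Proof.
rewrite /translation mulmxDl mulmxBl mul1mx -!mulmxA mulmxBl -scalemxAl.
rewrite !lorentz_rowE mul_mx_scalar scale_scalar_mx -raddfB /=.
by rewrite mul_mx_scalar.
Qed.

Lemma quadQ_translation m (a : 'cV[R]_m) p : quadQ (translation a *m p) = quadQ p.
Proof.
rewrite translationE -scaleNr quadQD quadQD !quadQZ quadQ_tangent quadQ_light.
rewrite lorentzDl !lorentzZr !lorentzZl lorentz_tangent_light.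
rewrite (lorentzC p) (lorentzC p).
by field.
Qed.

Lemma translationD m (a b : 'cV[R]_m) :
  translation (a + b) = translation a *m translation b.
Proof.
apply: eq_mulmx_cV => p; rewrite -mulmxA (translationE b).
set q := (X in _ = _ *m X).
have ql : lorentz (light (-1)) q = lorentz (light (-1)) p.
  rewrite /q -scaleNr !lorentzDr !lorentzZr lorentzxx quadQ_light.
  by rewrite lorentz_light_tangent; ring.
have qa : lorentz (tangent a) q =
    lorentz (tangent a) p - lorentz (light (-1)) p * dot a b.
  rewrite /q -scaleNr !lorentzDr !lorentzZr lorentz_tangent_light.
  by rewrite (lorentz_tangent a (tangent b)) [in dot a _]/tangent !col_mxKu; ring.
rewrite !translationE ql qa /q tangentD lorentzDl sqnormD.
set u := lorentz (light _) p; set A := lorentz (tangent a) p.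
set B := lorentz (tangent b) p; set l := light _.
rewrite scalerDr opprD !addrA -!addrA; congr (_ + _).
rewrite addrCA; congr (_ + _); rewrite [RHS]addrCA; congr (_ + _).
by rewrite -scalerDl; congr (_ *: _); field.
Qed.

Lemma translation0 m : translation (0 : 'cV[R]_m) = 1%:M.
Proof.
apply: eq_mulmx_cV => p; rewrite translationE mul1mx lorentz_tangent dot0l.
rewrite -[sqnorm 0]dotxx dot0l mul0r mul0r subr0 scale0r addr0.
by rewrite /tangent !col_mx0 scaler0 subr0.
Qed.

(** The determinant of an isometry is a square root of [1], and the translation by
    [a] is the square of the translation by half of [a]. *)
Lemma SOQ_translation m (a : 'cV[R]_m) : SOQ R (m + 1) (translation a).
Proof.
split; last exact: quadQ_translation.
have -> : a = 2^-1 *: a + 2^-1 *: a by rewrite -scalerDl -[LHS]scale1r; congr (_ *: _); field.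
by rewrite translationD det_mulmx -expr2 det_isometry//; exact: quadQ_translation.
Qed.

Lemma to_hyperboloid_translation m (a : 'cV[R]_m) (z : 'cV[R]_(m + 1)) :
  half_space R m z ->
  to_hyperboloid (z + col_mx a 0) = translation a *m to_hyperboloid z.
Proof.
move=> hz; have la : last_coord (z + col_mx a 0) = last_coord z.
  by rewrite last_coordD {2}/last_coord col_mxKd mxE addr0.
have t0 : last_coord z != 0 by rewrite gt_eqF.
rewrite translationE !to_hyperboloidE//; last by rewrite /half_space/= la.
rewrite la lorentz_tangent lorentz_light !(col_mxKu, last_coord_col).
rewrite usubmxD col_mxKu [in RHS]dotC dotZl.
have -> : sqnorm (z + col_mx a 0) = sqnorm z + 2 * dot (usubmx z) a + sqnorm a.
  rewrite sqnormD -[sqnorm (col_mx a 0)]dotxx !dot_split !col_mxKu dotxx.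
  by rewrite /last_coord !col_mxKd !mxE; ring.
rewrite /tangent /light /last_basis !scale_col_mx opp_col_mx !add_col_mx.
rewrite !(scaler0, oppr0, add_col_mx, opp_col_mx, scale_col_mx, addr0).
set t := last_coord z in t0 *.
congr col_mx; first congr col_mx.
- rewrite scalerDr -scaleNr; congr (_ + _ *: _); by field.
- rewrite !scale_scalar_mx -raddfD /=; congr _%:M; by field.
- rewrite !scale_scalar_mx -raddfD /=; congr _%:M; by field.
Qed.

Lemma half_space_act_translation m (a : 'cV[R]_m) (z : 'cV[R]_(m + 1)) :
  half_space R m z -> half_space_act (translation a) z = z + col_mx a 0.
Proof.
move=> hz; rewrite /half_space_act -to_hyperboloid_translation// to_hyperboloidK//.
by rewrite /half_space /= last_coordD [X in _ + X]/last_coord col_mxKd mxE addr0.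
Qed.

End Translations.

(** * Arithmetic of the group *)

Section Integrality.
Context {R : realType}.

Definition int_mx {k l} (A : 'M[R]_(k, l)) := forall i j, A i j \is a Num.int.

Lemma int_mxD k l (A B : 'M[R]_(k, l)) : int_mx A -> int_mx B -> int_mx (A + B).
Proof. by move=> hA hB i j; rewrite mxE rpredD. Qed.

Lemma int_mxZ k l c (A : 'M[R]_(k, l)) :
  c \is a Num.int -> int_mx A -> int_mx (c *: A).
Proof. by move=> hc hA i j; rewrite mxE rpredM. Qed.

Lemma int_mxN k l (A : 'M[R]_(k, l)) : int_mx A -> int_mx (- A).
Proof. by move=> hA i j; rewrite mxE rpredN. Qed.

Lemma int_mxM k l n (A : 'M[R]_(k, l)) (B : 'M[R]_(l, n)) :
  int_mx A -> int_mx B -> int_mx (A *m B).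
Proof. by move=> hA hB i j; rewrite mxE rpred_sum// => e _; rewrite rpredM. Qed.

Lemma int_mx_scalar k c : c \is a Num.int -> int_mx (c%:M : 'M[R]_k).
Proof. by move=> hc i j; rewrite mxE rpredMn. Qed.

Lemma int_mx_col k l n (A : 'M[R]_(k, n)) (B : 'M[R]_(l, n)) :
  int_mx A -> int_mx B -> int_mx (col_mx A B).
Proof. by move=> hA hB i j; rewrite mxE; case: (fintype.split _) => e. Qed.

Lemma int_mx_row k l n (A : 'M[R]_(n, k)) (B : 'M[R]_(n, l)) :
  int_mx A -> int_mx B -> int_mx (row_mx A B).
Proof. by move=> hA hB i j; rewrite mxE; case: (fintype.split _) => e. Qed.

Lemma int_mx0 k l : int_mx (0 : 'M[R]_(k, l)).
Proof. by move=> i j; rewrite mxE rpred0. Qed.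

Lemma int_lorentz_row k (p : 'cV[R]_(k + 1)) : int_mx p -> int_mx (lorentz_row p).
Proof.
move=> hp; apply: int_mx_row => [i j|]; first by rewrite !mxE.
by apply: int_mx_scalar; rewrite rpredN /last_coord mxE.
Qed.

Lemma int_light m c : c \is a Num.int -> int_mx (light c : 'cV[R]_(m + 1 + 1)).
Proof.
move=> hc; apply: int_mx_col; last exact/int_mx_scalar/rpred1.
apply: int_mxZ => //; apply: int_mx_col; first exact: int_mx0.
exact/int_mx_scalar/rpred1.
Qed.

Lemma int_tangent m (a : 'cV[R]_m) : int_mx a -> int_mx (tangent a).
Proof.
move=> ha; apply: int_mx_col; last exact: int_mx0.
by apply: int_mx_col => //; exact: int_mx0.
Qed.

(** The factor [2] makes [sqnorm (2 *: a) / 2] an integer. *)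
Lemma SOQ_Z_translation m (a : 'cV[R]_m) :
  int_mx a -> SOQ_Z R (m + 1) (translation (2 *: a)).
Proof.
move=> ha; split; first exact: SOQ_translation.
have hl : int_mx (light (-1) : 'cV[R]_(m + 1 + 1)).
  by apply: int_light; rewrite rpredN rpred1.
have ht : int_mx (tangent (2 *: a)).
  by apply/int_tangent/int_mxZ => //; rewrite rpred_nat.
apply: int_mxD.
  apply: int_mxD; first exact/int_mx_scalar/rpred1.
  by apply: int_mxN; apply: int_mxM => //; exact: int_lorentz_row.
apply: int_mxM => //; apply: int_mxD; first exact: int_lorentz_row.
apply: int_mxN; apply: int_mxZ; last exact: int_lorentz_row.
rewrite sqnormZ (_ : _ / 2 = 2 * sqnorm a); last by field.
by rewrite rpredM ?rpred_nat// rpred_sum// => i _; rewrite rpredX.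
Qed.

Lemma rational_denominator k l (A : 'M[R]_(k, l)) :
  (forall i j, range (@ratr R) (A i j)) ->
  exists2 N : nat, (0 < N)%N & int_mx (N%:R *: A).
Proof.
move=> /(_ _ _)/cid2/= rA.
have {rA} [q qA] : exists q : 'I_k -> 'I_l -> rat, forall i j, ratr (q i j) = A i j.
  by exists (fun i j => s2val (rA i j)) => i j; case: (rA i j).
pose d i j := `|denq (q i j)|%N.
have d0 i j : (0 < d i j)%N by rewrite absz_gt0 denq_eq0.
exists (\prod_i \prod_j d i j)%N; first by apply: prodn_gt0 => i; exact: prodn_gt0.
move=> i j; rewrite mxE (bigD1 i)//= (bigD1 j)//= -mulnA natrM mulrAC rpredM ?rpred_nat//.
rewrite -qA /d pmulrn absz_denq /ratr mulrCA divff ?mulr1 ?intr_int//.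
by rewrite intr_eq0 denq_eq0.
Qed.

Lemma finite_bounded_int_mx k l (N : nat) (M : R) : (0 < N)%N ->
  finite_set [set A : 'M[R]_(k, l) |
    int_mx (N%:R *: A) /\ forall i j, `|A i j| <= M].
Proof.
move=> N0; pose K := Num.truncn (N%:R * M).
have Nn : (N%:R : R) != 0 by rewrite pnatr_eq0 -lt0n.
pose f (B : 'M['I_(K + K).+1]_(k, l)) : 'M[R]_(k, l) :=
  \matrix_(i, j) (N%:R^-1 * ((B i j)%:R - K%:R)).
apply: (@sub_finite_set _ _ (f @` setT)); last exact/finite_image/finite_finset.
move=> A [hA AM]; exists (\matrix_(i, j)
   inord (Num.truncn (N%:R * A i j + K%:R))) => //.
apply/matrixP => i j; rewrite !mxE.
have := hA i j; rewrite mxE => /intrP[z zE]; rewrite zE.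
have zK : `|z%:~R : R| <= N%:R * M.
  by rewrite -zE normrM normr_nat ler_wpM2l.
have zK' : (`|z| <= K)%N.
  rewrite /K -(@natrK R `|z|%N); apply: le_truncn.
  by rewrite natr_absz intr_norm.
(* The shift by [K] makes the integral entries natural numbers below [(K + K).+1]. *)
have [n nE] : exists n : nat, (z + K%:Z)%R = n%:Z /\ (n < (K + K).+1)%N.
  exists `|(z + K%:Z)%R|%N; lia.
case: nE => nE nK.
have -> : z%:~R + K%:R = n%:R :> R by rewrite !pmulrn -intrD nE.
rewrite natrK inordK//.
have -> : n%:R - K%:R = z%:~R :> R by rewrite !pmulrn -intrB -nE addrK.
by rewrite -zE mulKf.
Qed.


Lemma finite_set_collision (T : choiceType) (A : set T) (f : nat -> T) :
  finite_set A -> (forall i, A (f i)) -> exists i j, (i < j)%N /\ f i = f j.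
Proof.
move=> /finite_seqP[s ->] fs; apply: contrapT => nocol.
have finj : injective f.
  move=> i j fij; case: (ltngtP i j) => // lt; case: nocol.
    by exists i, j.
  by exists j, i.
have uf : uniq (map f (iota 0 (size s).+1)) by rewrite map_inj_uniq// iota_uniq.
suff : (size (map f (iota 0 (size s).+1)) <= size s)%N by rewrite size_map size_iota ltnn.
by apply: uniq_leq_size => // _ /mapP[i _ ->]; exact: fs.
Qed.

End Integrality.

Section ArithmeticGroup.
Context {R : realType} {m : nat} (Gamma : SOQ0_subgroup R (m + 1)).

Local Notation G := (subgroup_carrier Gamma).

(** [Gamma] is a finite union of cosets [b L] of a group [L] of integral matrices; a
    denominator of [b] works for the whole coset. *)
Lemma commensurable_denominator :
  G `<=` SOQ_Q R (m + 1) -> finite_index (SOQ_Z R (m + 1)) G ->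
  exists2 N : nat, (0 < N)%N & forall g, G g -> int_mx (N%:R *: g).
Proof.
move=> GQ /finite_seqP[s sE].
pose L := SOQ_Z R (m + 1) `&` G.
have one_coset C : C \in s ->
    exists2 N : nat, (0 < N)%N & forall g, C g -> int_mx (N%:R *: g).
  move=> Cs; have : [set` s] C by [].
  rewrite -sE => -[b Gb <-]; have [N N0 Nb] := rational_denominator (GQ b Gb).2.
  exists N => // g [c [[_ cZ] _] <-]; rewrite scalemxAl.
  exact: int_mxM.
have [N N0 sN] : exists2 N : nat, (0 < N)%N &
    forall C, C \in s -> forall g, C g -> int_mx (N%:R *: g).
  elim: (s) one_coset => [|C s' IH] H; first by exists 1%N.
  have [N1 N10 HN1] := H C (mem_head _ _).
  have [|N2 N20 HN2] := IH; first by move=> D Ds; apply: H; rewrite inE Ds orbT.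
  exists (N1 * N2)%N => [|D]; first by rewrite muln_gt0 N10.
  rewrite inE => /orP[/eqP->|Ds] g Dg; rewrite natrM.
    by rewrite mulrC -scalerA; apply: int_mxZ; [exact: rpred_nat|exact: HN1].
  by rewrite -scalerA; apply: int_mxZ; [exact: rpred_nat|exact: (HN2 D)].
exists N => // g Gg.
have : [set [set b *m c | c in L] | b in G] [set g *m c | c in L].
  by exists g.
rewrite sE => gs; apply: (sN _ gs); exists 1%:M; last exact: mulmx1.
split; last exact: subgroup1.
split; last exact/int_mx_scalar/rpred1.
exact: (GQ _ (subgroup1 Gamma)).1.
Qed.

Lemma subgroup_translationD (a b : 'cV[R]_m) :
  G (translation a) -> G (translation b) -> G (translation (a + b)).
Proof. by rewrite translationD; exact: subgroupM. Qed.

Lemma subgroup_translationN (a : 'cV[R]_m) :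
  G (translation a) -> G (translation (- a)).
Proof.
move=> /subgroupV; congr (_ _).
have aN : translation (- a) *m translation a = 1%:M.
  by rewrite -translationD addNr translation0.
have ua : translation a \in unitmx by rewrite unitmxE (SOQ_translation a).1 unitr1.
by rewrite -[RHS]mulmx1 -(mulmxV ua) mulmxA aN mul1mx.
Qed.

Lemma subgroup_translationMz (a : 'cV[R]_m) (z : int) :
  G (translation a) -> G (translation (z%:~R *: a)).
Proof.
move=> Ga; have nat_case n : G (translation (n%:R *: a)).
  elim: n => [|n IH]; first by rewrite scale0r translation0; exact: subgroup1.
  by rewrite -natr1 scalerDl scale1r; exact: subgroup_translationD.
case: z => n; first by rewrite -pmulrn.
by rewrite NegzE mulrNz scaleNr -pmulrn; exact: subgroup_translationN.
Qed.

(** Among the integral translations along one axis, two lie in the same coset of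
    [Gamma `&` SOQ_Z]; their difference is in [Gamma]. *)
Lemma commensurable_translations : finite_index G (SOQ_Z R (m + 1)) ->
  exists2 D : nat, (0 < D)%N & forall b : 'I_m -> int,
    G (translation (\col_i (D%:R * (b i)%:~R))).
Proof.
move=> fin; pose e (l : 'I_m) : 'cV[R]_m := delta_mx l 0.
have axis l : exists d : nat, (0 < d)%N /\ G (translation (d%:R *: e l)).
  pose t i := translation (2 *: (i%:R *: e l)).
  have tZ i : SOQ_Z R (m + 1) (t i).
    apply: SOQ_Z_translation; apply: int_mxZ; first exact: rpred_nat.
    by move=> j k; rewrite mxE rpred_nat.
  pose L := G `&` SOQ_Z R (m + 1).
  have [] := @finite_set_collision _ _ (fun i => [set t i *m c | c in L]) fin.
    by move=> i; exists (t i).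
  move=> i [j [ij tij]]; exists (2 * (j - i))%N; split; first by rewrite muln_gt0 subn_gt0.
  have : [set t j *m c | c in L] (t j).
    exists 1%:M; last exact: mulmx1.
    split; first exact: subgroup1.
    by rewrite -translation0 -(scaler0 _ (2 : R)); apply: SOQ_Z_translation; exact: int_mx0.
  rewrite -tij => -[c [Gc _] cE].
  suff -> : translation ((2 * (j - i))%:R *: e l) = c by [].
  have -> : (2 * (j - i))%:R *: e l = - (2 *: (i%:R *: e l)) + 2 *: (j%:R *: e l).
    rewrite natrM natrB ?(ltnW ij)// -scalerA scalerBl scalerBr.
    by rewrite addrC.
  rewrite translationD -[translation (2 *: (j%:R *: e l))]/(t j) -cE mulmxA -translationD addNr.
  by rewrite translation0 mul1mx.
have [d dP] := choice axis.
exists (\prod_l d l)%N; first by apply: prodn_gt0 => l; have [] := dP l.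
move=> b; pose a l : 'cV[R]_m :=
  ((\prod_(i | i != l) d i)%:Z * b l)%:~R *: ((d l)%:R *: e l).
have -> : \col_i ((\prod_l d l)%:R * (b i)%:~R) = \sum_l a l :> 'cV[R]_m.
  apply/matrixP => i j; rewrite mxE summxE [RHS](bigD1 i)//= [X in _ = _ + X]big1 => [|k ki].
    rewrite addr0 !mxE eqxx (ord1 j) eqxx mulr1 intrM -pmulrn mulrAC -natrM mulnC.
    by rewrite (bigD1 i).
  by rewrite !mxE [i == k]eq_sym (negbTE ki) !mulr0.
elim/big_rec: _ => [|l x _ Gx]; first by rewrite translation0; exact: subgroup1.
by apply: subgroup_translationD => //; apply: subgroup_translationMz; have [] := dP l.
Qed.

End ArithmeticGroup.

(** * The projected ray is closed *)

Section Closed.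
Context {R : realType}.

Context {m : nat} (Gamma : SOQ0_subgroup R (m + 1)).

Local Notation G := (subgroup_carrier Gamma).

Lemma subgroup_SOQ g : G g -> SOQ R (m + 1) g.
Proof. by move=> /subgroup_sub/connected_component_sub. Qed.

Lemma subgroup_unitmx g : G g -> g \in unitmx.
Proof. by move=> /subgroup_SOQ[gd _]; rewrite unitmxE gd unitr1. Qed.

(** A rational light vector has an orbit with bounded denominators, so its images
    stay away from [0]: the bound [Y] on [q] limits how deep the points of its
    orbit are in the two cusps. *)
Lemma light_lower_bound (N : nat) (Y : R) g q (c : R) :
  (0 < N)%N -> (forall h, G h -> int_mx (N%:R *: h)) -> G g ->
  hyperboloid R (m + 1) q -> last_coord q <= Y -> c \is a Num.int -> c ^+ 2 = 1 ->
  (2 * Y * N%:R)^-1 <= `|lorentz (light c) (g *m q)|.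
Proof.
move=> N0 GN Gg hq qY cZ c1.
have ug := subgroup_unitmx Gg; have gS := subgroup_SOQ Gg.
pose a := invmx g *m light c.
have ga : g *m a = light c by rewrite /a mulmxA mulmxV// mul1mx.
have Qa : quadQ a = 0 by rewrite -gS.2 ga quadQ_light c1 subrr.
have y0 := hq.2; have Y0 : 0 < Y by exact: lt_le_trans qY.
have N0' : 0 < N%:R :> R by rewrite ltr0n.
have la0 : last_coord a != 0.
  apply/negP => /eqP la0; move: Qa; rewrite /quadQ la0 expr0n subr0 => /sqnorm_eq0 ua0.
  have a0 : a = 0.
    rewrite -(col_mx_last a) ua0 la0 (_ : 0%:M = 0) ?col_mx0//.
    exact: raddf0.
  have := last_light m c; rewrite -ga a0 mulmx0 /last_coord !mxE => /eqP.
  by rewrite eq_sym oner_eq0.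
have laN : 1 <= N%:R * `|last_coord a|.
  have : last_coord (N%:R *: a) \is a Num.int.
    rewrite /last_coord mxE /a scalemxAl; apply: int_mxM; last exact: int_light.
    exact/GN/subgroupV.
  rewrite last_coordZ => /intrP[z zE]; rewrite -[N%:R]normr_nat -normrM zE.
  rewrite -intr_norm -[1]/(1%:~R) ler_int -gtz0_ge1 normr_gt0 -(intr_eq0 R) -zE.
  by rewrite mulf_neq0// gt_eqF.
have := @last_coord_bound _ _ 0 a q (lexx _).
rewrite expr0n Qa mul0r addr0 => /(_ (lexx _) hq).
rewrite -(SOQ_lorentz a q gS) ga => lb.
rewrite -div1r ler_pdivrMr ?mulr_gt0//; apply: (le_trans laN).
set L := `|lorentz _ _| in lb *; have L0 : 0 <= L by exact: normr_ge0.
have : 2 * last_coord q * L <= 2 * Y * L by rewrite ler_wpM2r// ler_wpM2l.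
move=> /(le_trans lb) lb'.
apply: (le_trans (ler_wpM2l (ltW N0') lb')).
by rewrite le_eqVlt; apply/orP; left; apply/eqP; ring.
Qed.

(** By [light_lower_bound] the point [g *m q] of the ray stays in a bounded part of
    the hyperboloid. The columns of [g] are images of unit vectors, and their
    products with [g *m q] are products of the unit vectors with [q], hence
    bounded; [last_coord_bound] bounds the columns. *)
Lemma ray_return_bounded (N : nat) (w : 'cV[R]_m) (Y : R) : (0 < N)%N ->
  (forall h, G h -> int_mx (N%:R *: h)) -> exists M : R, forall g q, G g ->
  hyperboloid R (m + 1) q -> last_coord q <= Y -> usubmx (usubmx (g *m q)) = w ->
  forall i j, `|g i j| <= M.
Proof.
move=> N0 GN; pose P := (1 + sqnorm w) / (2 * Y * N%:R)^-1.
exists (1 + 2 * (2 * P * (2 * Y + P))) => g q Gg hq qY gqw i j.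
have gS := subgroup_SOQ Gg.
have hp : hyperboloid R (m + 1) (g *m q).
  exact: (SOQ0_hyperboloid (subgroup_sub Gg)).
have y0 := hq.2; have Y0 : 0 < Y by exact: lt_le_trans qY.
have N0' : 0 < N%:R :> R by rewrite ltr0n.
have pP : last_coord (g *m q) <= P.
  apply: ray_last_coord_bound => //; first by rewrite invr_gt0 !mulr_gt0.
  - by apply: light_lower_bound; rewrite ?expr1n ?rpred1.
  - by apply: light_lower_bound; rewrite ?sqrrN ?expr1n ?rpredN ?rpred1.
pose e : 'cV[R]_(m + 1 + 1) := delta_mx j 0.
have e1 : sqnorm e = 1.
  rewrite /sqnorm (bigD1 j)//= big1 => [|k kj]; first by rewrite !mxE !eqxx expr1n addr0.
  by rewrite !mxE (negbTE kj) expr0n.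
have Qge : quadQ (g *m e) <= 1.
  by rewrite gS.2 /quadQ; move: e1; rewrite sqnormE; have := sqr_ge0 (last_coord e); lra.
have := coord_bound i Qge; rewrite -colE mxE => gij; apply: (le_trans gij).
have p0 := hp.2.
rewrite lerD2l ler_pM2l//.
have := @last_coord_bound _ _ 1 (g *m e) _ ler01 _ hp.
rewrite expr1n mul1r (SOQ_lorentz e q gS) => /(_ Qge); rewrite -colE => h; apply: (le_trans h).
have := @lorentz_bound _ _ e q _ hq; rewrite e1 lexx => /(_ isT) eq.
by apply: ler_pM; rewrite ?mulr_ge0 ?addr_ge0 ?(ltW p0)//; lra.
Qed.

Lemma orbit_projP (z w : half_space R m) : orbit_proj Gamma z = orbit_proj Gamma w <->
  exists2 g, G g & half_space_act g (set_val z) = set_val w.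
Proof.
rewrite /orbit_proj; split => [/eqquotP/asboolP//|zw].
by apply/eqquotP/asboolP.
Qed.

Definition half_space_point (x : 'cV[R]_(m + 1)) (hx : half_space R m x) : half_space R m :=
  SigSub (mem_set hx).

Lemma orbit_ray_preimage (w : 'cV[R]_m) (z : half_space R m) :
  (orbit_proj Gamma @` half_space_ray w) (orbit_proj Gamma z) <->
  exists2 g, G g & usubmx (usubmx (g *m to_hyperboloid (set_val z))) = w.
Proof.
have hz : half_space R m (set_val z) := set_valP z.
split => [[x /half_space_rayE xw /esym/orbit_projP[g Gg gzx]]|[g Gg gz]].
  exists g => //; rewrite -xw -gzx /half_space_act to_half_spaceK//.
  exact/(SOQ0_hyperboloid (subgroup_sub Gg))/to_hyperboloid_hyperboloid.
have hx := half_space_act_half_space (subgroup_sub Gg) hz.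
exists (half_space_point hx); last by apply/esym/orbit_projP; exists g.
apply/half_space_rayE; rewrite -gz; congr (usubmx (usubmx _)).
rewrite [LHS]to_half_spaceK//.
exact/(SOQ0_hyperboloid (subgroup_sub Gg))/to_hyperboloid_hyperboloid.
Qed.

Lemma continuous_mul (X : topologicalType) (f g : X -> R) :
  continuous f -> continuous g -> continuous (fun x => f x * g x).
Proof. by move=> fc gc x; apply: (@cvgM _ _ _ (nbhs_filter x)); [exact: fc|exact: gc]. Qed.

Lemma continuous_add (X : topologicalType) (f g : X -> R) :
  continuous f -> continuous g -> continuous (fun x => f x + g x).
Proof.
by move=> fc gc x; apply: (@cvgD R R^o X _ (nbhs_filter x)); [exact: fc|exact: gc].
Qed.

Lemma continuous_inv (X : topologicalType) (f : X -> R) :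
  (forall x, f x != 0) -> continuous f -> continuous (fun x => (f x)^-1).
Proof. by move=> f0 fc x; apply: (@cvgV _ _ _ (nbhs_filter x)) => //; exact: fc. Qed.

Lemma half_space_coord_continuous i :
  continuous (fun z : half_space R m => set_val z i 0).
Proof.
move=> z; apply: (@continuous_comp _ _ _ (set_val : half_space R m -> _)
  (fun x : 'cV[R]_(m + 1) => x i 0)).
  exact: initial_continuous.
exact: mx_entry_continuous.
Qed.

Lemma to_hyperboloid_coord_continuous i :
  continuous (fun z : half_space R m => to_hyperboloid (set_val z) i 0).
Proof.
pose t (z : half_space R m) : R := last_coord (set_val z).
have tc : continuous t.
  have -> : t = fun z => set_val z (rshift m 0) 0 by apply/funext => z; rewrite /t /last_coord mxE.
  exact: half_space_coord_continuous.
have t0 z : t z != 0 by rewrite gt_eqF//; exact: (set_valP z).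
have t20 z : 2 * t z != 0 by rewrite mulf_neq0.
pose s (z : half_space R m) : R := sqnorm (set_val z).
have sc : continuous s.
  apply: (@continuous_big _ _ _ _ _ (@add_continuous R^o)) => j _ z.
  apply: (@continuous_comp _ _ _ (fun z : half_space R m => set_val z j 0)
    (fun x : R => x ^+ 2)); first exact: half_space_coord_continuous.
  exact: exprn_continuous.
have -> : (fun z : half_space R m => to_hyperboloid (set_val z) i 0) =
   fun z => col_mx (col_mx ((t z)^-1 *: usubmx (set_val z)) ((1 - s z) / (2 * t z))%:M)
                   ((1 + s z) / (2 * t z))%:M i 0.
  by apply/funext => z; rewrite to_hyperboloidE//; exact: (set_valP z).
have c1 (a : R) : continuous (fun _ : half_space R m => a) by exact: cst_continuous.
have t2c : continuous (fun z => (2 * t z)^-1).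
  by apply: continuous_inv => //; apply: continuous_mul.
case: (fintype.splitP i) => [j ij|j ij].
  have -> : i = lshift 1 j by exact: val_inj.
  case: (fintype.splitP j) => [k jk|k jk].
    have -> : j = lshift 1 k by exact: val_inj.
    under eq_fun do rewrite !col_mxEu !mxE.
    apply: continuous_mul; first exact: continuous_inv.
    exact: half_space_coord_continuous.
  have -> : j = rshift m k by exact: val_inj.
  rewrite [X in continuous X](_ : _ = fun z => (1 - s z) / (2 * t z)); last first.
    by apply/funext => z; rewrite col_mxEu col_mxEd mxE (ord1 k) eqxx mulr1n.
  apply: continuous_mul; last exact: t2c.
  apply: continuous_add; first exact: c1.
  under eq_fun do rewrite -mulN1r.
  by apply: continuous_mul; [exact: c1|exact: sc].
have -> : i = rshift (m + 1) j by exact: val_inj.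
rewrite [X in continuous X](_ : _ = fun z => (1 + s z) / (2 * t z)); last first.
  by apply/funext => z; rewrite col_mxEd mxE (ord1 j) eqxx mulr1n.
apply: continuous_mul; last exact: t2c.
by apply: continuous_add; [exact: c1|exact: sc].
Qed.

Lemma closed_translate_ray (g : 'M[R]_(m + 1 + 1)) (w : 'cV[R]_m) :
  closed [set z : half_space R m |
    usubmx (usubmx (g *m to_hyperboloid (set_val z))) = w].
Proof.
pose f i (z : half_space R m) : R :=
  (g *m to_hyperboloid (set_val z)) (lshift 1 (lshift 1 i)) 0.
have fc i : continuous (f i).
  have -> : f i = fun z => \sum_j g (lshift 1 (lshift 1 i)) j * to_hyperboloid (set_val z) j 0.
    by apply/funext => z; rewrite /f mxE.
  apply: (@continuous_big _ _ _ _ _ (@add_continuous R^o)) => j _.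
  apply: continuous_mul; last exact: to_hyperboloid_coord_continuous.
  exact: cst_continuous.
have -> : [set z : half_space R m |
    usubmx (usubmx (g *m to_hyperboloid (set_val z))) = w] =
    \bigcap_i (f i @^-1` [set w i 0]).
  apply/seteqP; split => [z <- i _ /=|z H]; first by rewrite /f !mxE.
  by apply/colP => i; have := H i I; rewrite /= /f => <-; rewrite !mxE.
apply: closed_bigI => i _; apply: preimage_closed; first by move=> x _; exact: fc.
exact: closed_eq.
Qed.

(** Near a given point only finitely many translates of the ray are visible. *)
Lemma closed_orbit_ray (w : 'cV[R]_m) :
  G `<=` SOQ_Q R (m + 1) -> finite_index (SOQ_Z R (m + 1)) G ->
  closed (orbit_proj Gamma @` half_space_ray w).
Proof.
move=> GQ fin; have [N N0 GN] := commensurable_denominator GQ fin.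
rewrite -openC.
suff : closed (orbit_proj Gamma @^-1` (orbit_proj Gamma @` half_space_ray w)).
  by rewrite -openC.
move=> z0 z0A.
pose C (g : 'M[R]_(m + 1 + 1)) := [set z : half_space R m |
    usubmx (usubmx (g *m to_hyperboloid (set_val z))) = w].
pose l (z : half_space R m) : R := last_coord (to_hyperboloid (set_val z)).
have lc : continuous l.
  have -> : l = fun z => to_hyperboloid (set_val z) (rshift (m + 1) 0) 0.
    by apply/funext => z; rewrite /l /last_coord mxE.
  exact: to_hyperboloid_coord_continuous.
(* The neighbourhood [l z < l z0 + 1] of [z0] meets the translates by [F] only. *)
have [M HM] := ray_return_bounded w (l z0 + 1) N0 GN.
pose F := G `&` [set g | int_mx (N%:R *: g) /\ forall i j, `|g i j| <= M].
have clB : closed (\bigcup_(g in F) C g).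
  apply: closed_bigcup => [|g _]; last exact: closed_translate_ray.
  by apply: finite_setIr; exact: finite_bounded_int_mx.
suff [g [Gg _] gz] : (\bigcup_(g in F) C g) z0 by apply/orbit_ray_preimage; exists g.
apply: clB => V Vz0.
have U : nbhs z0 [set z | l z < l z0 + 1].
  by apply: (lc z0 [set r | r < l z0 + 1]); apply: lt_nbhsl; rewrite ltrDl.
have [z [/orbit_ray_preimage[g Gg gz] [Vz lz]]] := z0A _ (filterI Vz0 U).
exists z; split => //; exists g => //; split => //; split; first exact: GN.
have hz : hyperboloid R (m + 1) (to_hyperboloid (set_val z)).
  exact/to_hyperboloid_hyperboloid/(set_valP z).
by apply: (HM g _ Gg hz) => //; exact: ltW.
Qed.

End Closed.

(** * The projected rays converge *)

Section Convergence.

Lemma chabauty_cvg (X : topologicalType) (F : set_system (closed_set X))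
    {FF : Filter F} (C : closed_set X) :
  (forall O, chabauty_subbase O -> O C -> F O) -> F --> C.
Proof.
move=> sub A; rewrite /= nbhsE => -[B [[D' D'sub DB] BC] BA].
apply: (filterS BA); move: BC; rewrite -DB; case=> [P DpO OC].
have [D fD OE] := D'sub P DpO.
apply: (@filterS _ _ _ P); first by move=> x Ox; exists P.
move: OC; rewrite -OE => OC.
apply: filter_bigI => i Di; apply: sub; last exact: OC.
by have := fD i Di; rewrite inE.
Qed.

Context {R : realType}.

(** An integral relation between the coordinates of [v] places [v] in a rational
    hyperplane. *)
Lemma generic_Z_independent m (v : 'cV[R]_m) (D : R) : (0 < m)%N -> D != 0 ->
  (forall (k : nat) (W : 'M[rat]_(k, m)),
     (\rank W < m)%N -> ~~ (v^T <= map_mx ratr W)%MS) ->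
  Z_independent m (fun i => oapp (fun i => v i 0) 0 (insub i) / D).
Proof.
move=> m0 D0 gen k; under eq_bigr do rewrite valK /= mulrA.
rewrite -mulr_suml => /eqP; rewrite mulf_eq0 invr_eq0 (negbTE D0) orbF => /eqP kv i im.
pose c : 'cV[rat]_m := \col_j (k j)%:~R.
apply/eqP/negPn/negP => ki0.
have rc : (0 < \rank c)%N.
  rewrite lt0n mxrank_eq0; apply/negP => /eqP/colP/(_ (Ordinal im)).
  by rewrite !mxE => /eqP; rewrite intr_eq0 (negbTE ki0).
have rk : (\rank (kermx c) < m)%N by rewrite mxrank_ker -subn_gt0 subKn ?rank_leq_row.
apply: (negP (gen _ _ rk)).
rewrite map_kermx; apply/sub_kermxP/matrixP => a b; rewrite !mxE -[RHS]kv.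
by apply: eq_bigr => j _; rewrite !mxE (ord1 a) rmorph_int mulrC.
Qed.

Context {m : nat} (Gamma : SOQ0_subgroup R (m + 1)).
Local Notation G := (subgroup_carrier Gamma).

(** At heights close to that of a point of [U] the ray has horizontal part [t *: s *: v],
    which for large [s] runs through a long segment of direction [v]; modulo the
    lattice of translations of [Gamma] this segment is almost dense. *)
Lemma orbit_ray_meets_open (v : 'cV[R]_m) (U : set (orbit_space Gamma)) :
  (0 < m)%N -> finite_index G (SOQ_Z R (m + 1)) ->
  (forall (k : nat) (W : 'M[rat]_(k, m)),
     (\rank W < m)%N -> ~~ (v^T <= map_mx ratr W)%MS) ->
  open U -> U !=set0 ->
  \forall s \near +oo, (orbit_proj Gamma @` half_space_ray (s *: v)) `&` U !=set0.
Proof.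
move=> m0 fin gen oU [u Uu].
have [D D0 DG] := commensurable_translations fin.
have Dr : 0 < D%:R :> R by rewrite ltr0n.
have [W oW WU] : open (orbit_proj Gamma @^-1` U) := oU.
pose z0 : half_space R m := repr u.
have Uz0 : U (orbit_proj Gamma z0) by rewrite /orbit_proj reprK.
have : nbhs (set_val z0) W.
  by apply: open_nbhs_nbhs; split => //; move: Uz0; rewrite -[U _]/((_ @^-1` _) z0) -WU.
move=> /nbhs_ballP[e /= e0 eW].
set x0 := set_val z0 in eW; have t00 : 0 < last_coord x0 := set_valP z0.
set t0 := last_coord x0 in t00.
pose v' i := oapp (fun i => v i 0) 0 (insub i) / D%:R.
have ind : Z_independent m v' by apply: generic_Z_independent; rewrite ?gt_eqF.
have eD : 0 < e / D%:R by rewrite divr_gt0.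
have [l l0 lP] := Kronecker_uniform ind eD.
(* For [l / e < s] the times [tau] in [[s * t0, s * t0 + l]] are the [s * t] with
   [t] in a subinterval of [[t0, t0 + e[]. *)
exists (l / e); split; first exact: num_real.
move=> s ls; have s0 : 0 < s by apply: le_lt_trans ls; rewrite divr_ge0 ?(ltW e0).
pose y i := oapp (fun i => usubmx x0 i 0) 0 (insub i) / D%:R.
have [tau /andP[t1 t2] [b bP]] := lP y (s * t0).
pose t := tau / s; have tt0 : t0 <= t by rewrite ler_pdivlMr// mulrC.
have tte : t < t0 + e.
  rewrite ltr_pdivrMr// (le_lt_trans t2)// mulrDl [t0 * s]mulrC ltrD2l.
  by rewrite mulrC -ltr_pdivrMr.
have tp : 0 < t by exact: lt_le_trans tt0.
pose a : 'cV[R]_m := \col_i (D%:R * (b i)%:~R).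
(* The translation by [a] moves [z], which is close to [z0], onto the ray. *)
pose z := col_mx (t *: (s *: v) - a) t%:M : 'cV[R]_(m + 1).
have hz : half_space R m z by rewrite /half_space/= last_coord_col.
have Wz : W z.
  apply: eW; split => // i j; rewrite (ord1 j) /ball /=.
  case: (fintype.splitP i) => [k ik|k ik].
    have -> : i = lshift 1 k by exact: val_inj.
    have := bP k (ltn_ord k); rewrite /z col_mxEu /v' /y valK /= !mxE => H.
    have tau_ts : tau = t * s by rewrite divfK ?gt_eqF.
    rewrite distrC -(ltr_pM2r (x := D%:R^-1)) ?invr_gt0//.
    rewrite -[X in _ * X]ger0_norm ?invr_ge0 ?(ltW Dr)// -normrM.
    apply: le_lt_trans H; rewrite le_eqVlt; apply/orP; left; apply/eqP; congr (`|_|).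
    by rewrite tau_ts; field; rewrite gt_eqF.
  have -> : i = rshift m k by exact: val_inj.
  rewrite /z col_mxEd mxE (ord1 k) eqxx mulr1n.
  have -> : x0 (rshift m 0) 0 = t0 by rewrite /t0 /last_coord mxE.
  by rewrite distrC ger0_norm; lra.
exists (orbit_proj Gamma (half_space_point hz)); split; last first.
  by rewrite -[U _]/((_ @^-1` _) _) -WU.
have hw : half_space R m (t *: col_mx (s *: v) 1%:M).
  by rewrite /half_space/= last_coordZ last_coord_col mulr1.
exists (half_space_point hw); first by exists t.
apply/esym/orbit_projP; exists (translation a); first exact: DG.
rewrite half_space_act_translation//.
rewrite [LHS]add_col_mx subrK addr0 [RHS]scale_col_mx scale_scalar_mx mulr1//.
Qed.

End Convergence.

(* The dimension n of the hyperbolic space is m + 1. *)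
Theorem theorem1p12 (R : realType) (m : nat) (n_ge2 : (2 <= m + 1)%N)
    (Gamma : SOQ0_subgroup R (m + 1))
    (GammaQ : Gamma `<=` SOQ_Q R (m + 1))
    (GammaZ : commensurable Gamma (SOQ_Z R (m + 1)))
    (v : 'cV[R]_m) (v_neq0 : v != 0)
    (v_generic : forall (k : nat) (W : 'M[rat]_(k, m)),
       (\rank W < m)%N -> ~~ (v^T <= map_mx ratr W)%MS) :
  exists ray_closed : forall s : R,
      closed (orbit_proj Gamma @` half_space_ray (s *: v)),
    ClosedSet (ray_closed s) @[s --> +oo] -->
      ClosedSet (@closedT (orbit_space Gamma)).
Proof.
have m0 : (0 < m)%N by move: n_ge2; rewrite addn1.
exists (fun s => closed_orbit_ray (w := s *: v) GammaQ GammaZ.2).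
apply: chabauty_cvg => O [[K _ ->]|[U oU ->]] /=.
  rewrite setTI => ->; apply: filterS filterT => s _ /=; exact: setI0.
by rewrite setTI; exact: orbit_ray_meets_open GammaZ.1 v_generic oU.
Qed.
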